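(* Let $1\le m<n$, let $(b_{ij})\in\mathbb{R}^{m\times(n-m)}$ and let $$A=(I_m,\,B_{m,n-m})=\begin{pmatrix}1&0&\cdots&0&b_{11}&\cdots&b_{1,n-m}\\0&1&\cdots&0&b_{21}&\cdots&b_{2,n-m}\\\vdots&\vdots&&\vdots&\vdots&&\vdots\\0&0&\cdots&1&b_{m1}&\cdots&b_{m,n-m}\end{pmatrix}\in\mathbb{R}^{m\times n}.$$ For $1\le i\le n-m$ and $1\le j\le5$ let $\boldsymbol{\tilde\xi}_{ij}\in\mathcal{X}^n$ be the vector whose $k$-th entry is $-b_{ki}\tilde e_j$ for $1\le k\le m$, whose $(m+i)$-th entry is $\tilde e_j$, and whose remaining entries are $\tilde 0$. Then every solution $\boldsymbol{\tilde x}\in\mathcal{X}^n$ of $A\boldsymbol{\tilde x}=\boldsymbol{\tilde 0}$ belongs to the subset of $\mathcal{X}^n$ spanned by the $5(n-m)$ fuzzy vectors $\boldsymbol{\tilde\xi}_{ij}$, i.e. has the form $$\boldsymbol{\tilde x}=\sum_{i=1}^{n-m}\sum_{j=1}^5c_{ij}\boldsymbol{\tilde\xi}_{ij},\qquad c_{ij}\in\mathbb{R}.$$ Furthermore, $A\boldsymbol{\tilde x}=\boldsymbol{\tilde b}$ is consistent (has at least one solution) for any given $\boldsymbol{\tilde b}\in\mathcal{X}^m$. If $\boldsymbol{\tilde\xi}^*$ is a solution of $A\boldsymbol{\tilde x}=\boldsymbol{\tilde b}$, then the solution set of $A\boldsymbol{\tilde x}=\boldsymbol{\tilde b}$ is the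 set of all fuzzy vectors of the form $$\boldsymbol{\tilde x}=\boldsymbol{\tilde\xi}^*+\sum_{i=1}^{n-m}\sum_{j=1}^5c_{ij}\boldsymbol{\tilde\xi}_{ij},\qquad c_{ij}\in\mathbb{R}.$$
   Context: Gaussian-PDMF space $\mathcal{X}$: the set of functions $f:\mathbb{R}\to[0,1]$ with parameters $x\in\mathbb{R}$, $d^-,d^+>0$, $\mu^-,\mu^+\in\mathbb{R}$, given by $f(x)=1$, $f(\tau)=0$ for $\tau\le x-d^-$ or $\tau\ge x+d^+$, $f(\tau)=\int_{-\infty}^{\tan(\frac{\pi}{d^-}(\tau-x+d^-)-\frac{\pi}{2})}\frac{1}{\sqrt{2\pi}}e^{-\frac12(t-\mu^-)^2}dt$ for $\tau\in(x-d^-,x)$, and $f(\tau)=\int_{-\infty}^{\tan(\frac{\pi}{d^+}(x+d^+-\tau)-\frac{\pi}{2})}\frac{1}{\sqrt{2\pi}}e^{-\frac12(t-\mu^+)^2}dt$ for $\tau\in(x,x+d^+)$. Such an element is identified with its parameter tuple, written $\tilde x=\langle x;d^-,d^+,\mu^-,\mu^+\rangle$; two elements are equal iff all five parameters coincide. Operations on $\mathcal{X}$, for $\tilde x_i=\langle x_i;d_i^-,d_i^+,\mu_i^-,\mu_i^+\rangle$ and $\lambda\in\mathbb{R}$: $\tilde x_1+\tilde x_2=\langle x_1+x_2;d_1^-d_2^-,d_1^+d_2^+,\mu_1^-+\mu_2^-,\mu_1^++\mu_2^+\rangle$; $\lambda\tilde x=\langle\lambda x;(d^-)^\lambda,(d^+)^\lambda,\lambda\mu^-,\lambda\mu^+\rangle$.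 With these operations $\mathcal{X}$ is a real vector space with zero element $\tilde 0=\langle 0;1,1,0,0\rangle$. Its standard basis is $\tilde e_1=\langle1;1,1,0,0\rangle$, $\tilde e_2=\langle0;e,1,0,0\rangle$, $\tilde e_3=\langle0;1,e,0,0\rangle$, $\tilde e_4=\langle0;1,1,1,0\rangle$, $\tilde e_5=\langle0;1,1,0,1\rangle$ ($e$ is Euler's number). $\mathcal{X}^n$ is the set of $n$-dimensional column vectors over $\mathcal{X}$ with entrywise addition and real scalar multiplication; $\boldsymbol{\tilde 0}=(\tilde 0,\dots,\tilde 0)^T$. For $A=(a_{ij})\in\mathbb{R}^{m\times n}$ and $\boldsymbol{\tilde x}=(\tilde x_1,\dots,\tilde x_n)^T\in\mathcal{X}^n$, $A\boldsymbol{\tilde x}\in\mathcal{X}^m$ is the vector with $i$-th entry $\sum_{k=1}^n a_{ik}\tilde x_k$. *)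

(* Defs.v *)
From HB Require Import structures.
From mathcomp Require Import all_boot all_order all_algebra.
From mathcomp Require Import all_classical all_reals all_analysis.

Set Implicit Arguments.
Unset Strict Implicit.
Unset Printing Implicit Defensive.

Import Order.TTheory GRing.Theory Num.Theory.

Local Open Scope classical_set_scope.
Local Open Scope ring_scope.

(* A Gaussian-PDMF <x; d-, d+, mu-, mu+> is represented by its parameters, so
   equality is equality of the five parameters; [gpdmf_fun] below is the
   membership function on the real line that it stands for. *)
Record gpdmf (R : realType) := Gpdmf {
  peak : R;
  dminus : {posnum R};
  dplus : {posnum R};
  muminus : R;
  muplus : R }.

(* The integral of the N(m, 1) density over ]-oo, a]. *)
Definition gauss_cdf (R : realType) (m a : R) : R :=
  \int[@lebesgue_measure R]_(t in `]-oo, a])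
    ((Num.sqrt (2 * pi))^-1 * expR (- (2^-1 * (t - m) ^+ 2))).

Definition gpdmf_fun (R : realType) (f : gpdmf R) (tau : R) : R :=
  let x := peak f in
  let dm := (dminus f)%:num in
  let dp := (dplus f)%:num in
  if tau == x then 1
  else if (tau <= x - dm) || (x + dp <= tau) then 0
  else if tau < x then
    gauss_cdf (muminus f) (tan (pi / dm * (tau - x + dm) - pi / 2))
  else
    gauss_cdf (muplus f) (tan (pi / dp * (x + dp - tau) - pi / 2)).

Coercion gpdmf_fun : gpdmf >-> Funclass.

Section GpdmfModule.
Variable R : realType.
Implicit Types (f g h : gpdmf R) (l : R).

Definition gpdmf_tuple f := (peak f, dminus f, dplus f, muminus f, muplus f).
Definition tuple_gpdmf (p : R * {posnum R} * {posnum R} * R * R) : gpdmf R :=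
  let: (x, dm, dp, mm, mp) := p in Gpdmf x dm dp mm mp.

Lemma gpdmf_tupleK : cancel gpdmf_tuple tuple_gpdmf.
Proof. by case. Qed.

HB.instance Definition _ := Choice.copy (gpdmf R) (can_type gpdmf_tupleK).

Definition gpdmf_zero : gpdmf R := Gpdmf 0 1%:pos 1%:pos 0 0.

Definition gpdmf_opp f : gpdmf R :=
  Gpdmf (- peak f) ((dminus f)%:num^-1)%:pos ((dplus f)%:num^-1)%:pos
        (- muminus f) (- muplus f).

Definition gpdmf_add f g : gpdmf R :=
  Gpdmf (peak f + peak g)
        ((dminus f)%:num * (dminus g)%:num)%:pos
        ((dplus f)%:num * (dplus g)%:num)%:pos
        (muminus f + muminus g) (muplus f + muplus g).

Definition gpdmf_scale l f : gpdmf R :=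
  Gpdmf (l * peak f)
        ((dminus f)%:num `^ l)%:pos ((dplus f)%:num `^ l)%:pos
        (l * muminus f) (l * muplus f).

Lemma gpdmf_eq f g :
  peak f = peak g -> (dminus f)%:num = (dminus g)%:num ->
  (dplus f)%:num = (dplus g)%:num ->
  muminus f = muminus g -> muplus f = muplus g -> f = g.
Proof.
by case: f g => [? ? ? ? ?] [? ? ? ? ?] /= -> /val_inj -> /val_inj -> -> ->.
Qed.

Lemma gpdmf_addA : associative gpdmf_add.
Proof. by move=> f g h; apply: gpdmf_eq; rewrite /= ?addrA ?mulrA. Qed.

Lemma gpdmf_addC : commutative gpdmf_add.
Proof.
by move=> f g; apply: gpdmf_eq => /=; first [exact: addrC | exact: mulrC].
Qed.

Lemma gpdmf_add0 : left_id gpdmf_zero gpdmf_add.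
Proof. by move=> f; apply: gpdmf_eq; rewrite /= ?add0r ?mul1r. Qed.

Lemma gpdmf_addN : left_inverse gpdmf_zero gpdmf_opp gpdmf_add.
Proof. by move=> f; apply: gpdmf_eq; rewrite /= ?addNr ?mulVf. Qed.

HB.instance Definition _ :=
  GRing.isZmodule.Build (gpdmf R) gpdmf_addA gpdmf_addC gpdmf_add0 gpdmf_addN.

Lemma gpdmf_scaleA a b f :
  gpdmf_scale a (gpdmf_scale b f) = gpdmf_scale (a * b) f.
Proof.
by apply: gpdmf_eq; rewrite /= ?mulrA // -powRrM mulrC.
Qed.

Lemma gpdmf_scale1 : left_id 1 gpdmf_scale.
Proof. by move=> f; apply: gpdmf_eq; rewrite /= ?mul1r ?powRr1. Qed.

Lemma gpdmf_scaleDr : right_distributive gpdmf_scale +%R.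
Proof. by move=> l f g; apply: gpdmf_eq; rewrite /= ?mulrDr ?powRM. Qed.

Lemma gpdmf_scaleDl f : {morph gpdmf_scale^~ f : a b / a + b}.
Proof.
move=> a b; apply: gpdmf_eq; rewrite /= ?mulrDl //;
  by rewrite powRD //; apply/implyP.
Qed.

HB.instance Definition _ := GRing.Zmodule_isLmodule.Build R (gpdmf R)
  gpdmf_scaleA gpdmf_scale1 gpdmf_scaleDr gpdmf_scaleDl.

End GpdmfModule.

(* e_1, ..., e_5 are indexed from 0. *)
Definition gpdmf_basis (R : realType) (j : 'I_5) : gpdmf R :=
  tnth [tuple Gpdmf 1 1%:pos 1%:pos 0 0;
              Gpdmf 0 (expR 1)%:pos 1%:pos 0 0;
              Gpdmf 0 1%:pos (expR 1)%:pos 0 0;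
              Gpdmf 0 1%:pos 1%:pos 1 0;
              Gpdmf 0 1%:pos 1%:pos 0 1] j.

(* X^n is {ffun 'I_n -> gpdmf R}, with its pointwise module structure; the
   library has no module structure on matrices with entries in a module. *)
Definition fuzzy_mulmx (R : realType) (m n : nat) (A : 'M[R]_(m, n))
    (x : {ffun 'I_n -> gpdmf R}) : {ffun 'I_m -> gpdmf R} :=
  [ffun i => \sum_(k < n) A i k *: x k].

(* The block matrix (I_m, B), cast from width m + (n - m) to width n. *)
Definition unit_block_mx (R : realType) (m n : nat) (lt_mn : (m < n)%N)
    (B : 'M[R]_(m, n - m)) : 'M[R]_(m, n) :=
  castmx (erefl m, subnKC (ltnW lt_mn)) (row_mx 1%:M B).

Definition fuzzy_xi (R : realType) (m n : nat) (lt_mn : (m < n)%N)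
    (B : 'M[R]_(m, n - m)) (i : 'I_(n - m)) (j : 'I_5) :
    {ffun 'I_n -> gpdmf R} :=
  [ffun k => match fintype.split (cast_ord (esym (subnKC (ltnW lt_mn))) k) with
             | inl k' => - B k' i *: gpdmf_basis R j
             | inr k' => if k' == i then gpdmf_basis R j else 0
             end].

(* Main.v *)
Require Import Defs.
From mathcomp Require Import all_boot all_order all_algebra.
From mathcomp Require Import all_classical all_reals all_analysis.
Import Order.TTheory GRing.Theory Num.Theory.
Local Open Scope ring_scope.

(** Write the unknown as a pair of blocks, the first [m] entries (pivots) and
    the last [n - m] entries (free).  Row [k] of the system [(I, B) x = 0] says
    that the pivot entry [x_k] is [- \sum_i B k i *: x_(m + i)]
    ([fuzzy_mulmx_unit_block]), so a solution is determined by its free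
    entries, which are arbitrary.  Every element of the space of Gaussian-PDMFs
    is a combination of the five basis elements ([gpdmf_basis_span]: take
    logarithms of the two widths), and the combination of the vectors
    [fuzzy_xi] with coefficients [c] is the solution whose free entries have
    coordinates [c] ([fuzzy_xi_comb_free], [fuzzy_xi_comb_pivot]).  Hence the
    kernel is exactly the span of these vectors ([fuzzy_kernelP]).  The right-hand
    side [b] is reached by the vector with pivot entries [b] and free entries
    [0]; and the general solution follows because multiplication by a matrix
    commutes with differences ([fuzzy_mulmxB]). *)

(** The coordinates of a Gaussian-PDMF in the basis [gpdmf_basis].  Widths add
    by multiplication and scale by powers, so theirs are logarithms. *)
Definition gpdmf_coord {R : realType} (f : gpdmf R) (j : 'I_5) : R :=
  tnth [tuple peak f; ln (dminus f)%:num; ln (dplus f)%:num;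
              muminus f; muplus f] j.

Lemma gpdmf_basis_span (R : realType) (f : gpdmf R) :
  f = \sum_(j < 5) gpdmf_coord f j *: gpdmf_basis R j.
Proof.
have expR1_powR (a : R) : expR 1 `^ a = expR a.
  by rewrite /powR gt_eqF ?expR_gt0// expRK mulr1.
rewrite !big_ord_recl big_ord0 /gpdmf_coord /gpdmf_basis !(tnth_nth 0) /=.
apply: gpdmf_eq; rewrite /= ?expR1_powR ?powR1 ?lnK ?posrE//;
  by rewrite ?mulr0 ?mulr1 ?mul1r ?addr0 ?add0r.
Qed.

Section UnitBlockSystem.
Context {R : realType} {m n : nat} (lt_mn : (m < n)%N).
Implicit Types (B : 'M[R]_(m, n - m)) (x y : {ffun 'I_n -> gpdmf R}).

(** The positions of the columns of the blocks [I] and [B] of [(I, B)]. *)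
Definition pivot_ord (k : 'I_m) : 'I_n :=
  cast_ord (subnKC (ltnW lt_mn)) (lshift (n - m) k).
Definition free_ord (i : 'I_(n - m)) : 'I_n :=
  cast_ord (subnKC (ltnW lt_mn)) (rshift m i).

Lemma split_pivot_ord k :
  fintype.split (cast_ord (esym (subnKC (ltnW lt_mn))) (pivot_ord k)) = inl k.
Proof. by rewrite cast_ordK; exact: (unsplitK (inl k)). Qed.

Lemma split_free_ord i :
  fintype.split (cast_ord (esym (subnKC (ltnW lt_mn))) (free_ord i)) = inr i.
Proof. by rewrite cast_ordK; exact: (unsplitK (inr i)). Qed.

Lemma eq_pivot_free x y :
  (forall k, x (pivot_ord k) = y (pivot_ord k)) ->
  (forall i, x (free_ord i) = y (free_ord i)) -> x = y.
Proof.
move=> eq_pivot eq_free; apply/ffunP => k.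
rewrite -(cast_ordKV (subnKC (ltnW lt_mn)) k).
case: (split_ordP (cast_ord (esym (subnKC (ltnW lt_mn))) k)) => i ->.
  exact: eq_pivot.
exact: eq_free.
Qed.

Lemma sum_pivot_free (F : 'I_n -> gpdmf R) :
  \sum_(k < n) F k =
  \sum_(k < m) F (pivot_ord k) + \sum_(i < n - m) F (free_ord i).
Proof.
rewrite (reindex (cast_ord (subnKC (ltnW lt_mn)))) ?big_split_ord//=.
by exists (cast_ord (esym (subnKC (ltnW lt_mn)))) => k _;
  rewrite ?cast_ordK ?cast_ordKV.
Qed.

Lemma fuzzy_mulmx_unit_block B x k :
  fuzzy_mulmx (unit_block_mx lt_mn B) x k =
  x (pivot_ord k) + \sum_(i < n - m) B k i *: x (free_ord i).
Proof.
rewrite ffunE sum_pivot_free; congr (_ + _).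
  rewrite (bigD1 k)//= big1 => [|l ne_lk].
    by rewrite castmxE !cast_ordK row_mxEl cast_ord_id mxE eqxx scale1r addr0.
  rewrite castmxE !cast_ordK row_mxEl cast_ord_id mxE eq_sym (negPf ne_lk).
  exact: scale0r.
by apply: eq_bigr => i _; rewrite castmxE !cast_ordK row_mxEr cast_ord_id.
Qed.

Lemma fuzzy_mulmxB p (A : 'M[R]_(p, n)) x y :
  fuzzy_mulmx A (x - y) = fuzzy_mulmx A x - fuzzy_mulmx A y.
Proof.
apply/ffunP => i; rewrite !ffunE -sumrB.
by apply: eq_bigr => k _; rewrite !ffunE scalerBr.
Qed.

Lemma fuzzy_xi_comb_free B (c : 'M[R]_(n - m, 5)) i :
  (\sum_(l < n - m) \sum_(j < 5) c l j *: fuzzy_xi lt_mn B l j) (free_ord i) =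
  \sum_(j < 5) c i j *: gpdmf_basis R j.
Proof.
rewrite sum_ffunE (bigD1 i)//= [X in _ + X]big1 => [|l ne_li].
  rewrite addr0 sum_ffunE; apply: eq_bigr => j _.
  by rewrite !ffunE split_free_ord eqxx.
rewrite sum_ffunE big1// => j _.
by rewrite !ffunE split_free_ord eq_sym (negPf ne_li) scaler0.
Qed.

Lemma fuzzy_xi_comb_pivot B (c : 'M[R]_(n - m, 5)) k :
  (\sum_(l < n - m) \sum_(j < 5) c l j *: fuzzy_xi lt_mn B l j) (pivot_ord k) =
  - \sum_(i < n - m) B k i *: \sum_(j < 5) c i j *: gpdmf_basis R j.
Proof.
rewrite sum_ffunE -sumrN; apply: eq_bigr => i _.
rewrite sum_ffunE -scaleNr scaler_sumr; apply: eq_bigr => j _.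
by rewrite !ffunE split_pivot_ord !scalerA mulrC.
Qed.

Lemma fuzzy_kernelP B x :
  fuzzy_mulmx (unit_block_mx lt_mn B) x = 0 <->
  exists c : 'M[R]_(n - m, 5),
    x = \sum_(i < n - m) \sum_(j < 5) c i j *: fuzzy_xi lt_mn B i j.
Proof.
split=> [/ffunP Ax0 | [c ->]].
  exists (\matrix_(i, j) gpdmf_coord (x (free_ord i)) j).
  have free_coord i : \sum_(j < 5)
      (\matrix_(i, j) gpdmf_coord (x (free_ord i)) j) i j *: gpdmf_basis R j =
      x (free_ord i).
    rewrite [RHS]gpdmf_basis_span.
    by apply: eq_bigr => j _; rewrite mxE.
  apply: eq_pivot_free => [k | i]; last by rewrite fuzzy_xi_comb_free free_coord.
  rewrite fuzzy_xi_comb_pivot; under eq_bigr do rewrite free_coord.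
  by apply/eqP; rewrite -addr_eq0 -fuzzy_mulmx_unit_block Ax0 ffunE.
apply/ffunP => k; rewrite fuzzy_mulmx_unit_block fuzzy_xi_comb_pivot ffunE.
by under [X in _ + X]eq_bigr do rewrite fuzzy_xi_comb_free; rewrite addNr.
Qed.

Lemma fuzzy_unit_block_consistent B (b : {ffun 'I_m -> gpdmf R}) :
  exists x, fuzzy_mulmx (unit_block_mx lt_mn B) x = b.
Proof.
exists [ffun k =>
  match fintype.split (cast_ord (esym (subnKC (ltnW lt_mn))) k) with
  | inl k' => b k'
  | inr _ => 0
  end].
apply/ffunP => k; rewrite fuzzy_mulmx_unit_block ffunE split_pivot_ord.
by rewrite big1 ?addr0// => i _; rewrite ffunE split_free_ord scaler0.
Qed.

End UnitBlockSystem.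

Theorem theorem3p3 (R : realType) (m n : nat) (m_ge1 : (1 <= m)%N)
    (lt_mn : (m < n)%N) (B : 'M[R]_(m, n - m)) :
  let A := unit_block_mx lt_mn B in
  let xi := fuzzy_xi lt_mn B in
  (forall x : {ffun 'I_n -> gpdmf R}, fuzzy_mulmx A x = 0 ->
     exists c : 'M[R]_(n - m, 5),
       x = \sum_(i < n - m) \sum_(j < 5) c i j *: xi i j) /\
  (forall b : {ffun 'I_m -> gpdmf R},
     exists x : {ffun 'I_n -> gpdmf R}, fuzzy_mulmx A x = b) /\
  (forall (b : {ffun 'I_m -> gpdmf R}) (xi_star : {ffun 'I_n -> gpdmf R}),
     fuzzy_mulmx A xi_star = b ->
     forall x : {ffun 'I_n -> gpdmf R},
       fuzzy_mulmx A x = b <->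
       exists c : 'M[R]_(n - m, 5),
         x = xi_star + \sum_(i < n - m) \sum_(j < 5) c i j *: xi i j).
Proof.
move=> A xi; split; first by move=> x /fuzzy_kernelP.
split=> [b | b xi_star Axi_star x]; first exact: fuzzy_unit_block_consistent.
split=> [Axb | [c x_eq]].
  have /fuzzy_kernelP[c x_eq] : fuzzy_mulmx A (x - xi_star) = 0.
    by rewrite fuzzy_mulmxB Axb Axi_star subrr.
  by exists c; rewrite -x_eq addrC subrK.
have /fuzzy_kernelP : exists c : 'M[R]_(n - m, 5),
    x - xi_star = \sum_(i < n - m) \sum_(j < 5) c i j *: xi i j.
  by exists c; rewrite x_eq addrC addKr.
by rewrite fuzzy_mulmxB Axi_star => /eqP; rewrite subr_eq0 => /eqP.
Qed.
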